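(* Let $\varphi: T \to T$ be a self-map for which $C_\varphi$ is bounded on $L_\mu^\infty$. Then $C_\varphi$ is Fredholm (on $L_\mu^\infty$) if and only if all of the following hold: (a) $T\setminus\varphi(T)$ is finite; (b) there exists $M \in \mathbb{N}$ such that $\varphi^{-1}(w)$ contains at most $M$ points for every $w \in \varphi(T)$; (c) $\varphi^{-1}(w)$ contains exactly one element for all but a finite number of points $w \in \varphi(T)$; (d) there is an $\varepsilon > 0$ such that $V_\varepsilon \cap S_w \ne \emptyset$ for every $w \in T$, where $$V_\varepsilon = \left\{v \in T : \frac{\mu(v)}{\mu(\varphi(v))} \ge \varepsilon\right\}, \qquad S_w = \{v \in T : \varphi(v) = \varphi(w)\}.$$
   Context: $(T,\mathrm{d})$ is a metric space with a distinguished point $o$ (the root); the length of $v \in T$ is $|v| = \mathrm{d}(o,v)$. $T$ is assumed locally finite (for every $M>0$ the set $\{v \in T : |v| < M\}$ is finite) and unbounded (for every $M>0$ there is $v \in T$ with $|v| \ge M$). $\mu: T \to (0,\infty)$ is an arbitrary positive function (a weight). $L_\mu^\infty$ is the Banach space of functions $f: T \to \mathbb{C}$ with $\|f\|_\mu = \sup_{v \in T} \mu(v)|f(v)| < \infty$. The composition operator is the linear map $C_\varphi f = f\circ\varphi$; it is bounded on $L_\mu^\infty$ if it is a bounded operator from $L_\mu^\infty$ to itself. Here $\varphi^{-1}(w)$ denotes the preimage $\{v \in T : \varphi(v) = w\}$. A bounded operator $A$ on a Banach space is Fredholm if it has closed range and both $\ker(A)$ and $\ker(A^* )$ are finite dimensional,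 where $A^*$ is the adjoint on the dual space; equivalently, there is a bounded operator $S$ such that $SA - I$ and $AS - I$ are both compact. *)

(* Defs.v *)
From HB Require Import structures.
From mathcomp Require Import all_boot all_order all_algebra.
From mathcomp Require Import complex.
From mathcomp Require Import all_classical all_reals all_analysis.

Set Implicit Arguments.
Unset Strict Implicit.
Unset Printing Implicit Defensive.

Import Order.TTheory GRing.Theory Num.Theory.
Import numFieldNormedType.Exports.
Import ComplexField.Normc.

Local Open Scope classical_set_scope.
Local Open Scope ring_scope.
Local Open Scope complex_scope.

Definition bounded_operator (K : numFieldType) (V W : normedModType K)
    (A : V -> W) : Prop :=
  exists M : K, forall x : V, `|A x| <= M * `|x|.

Section Dual.
Variables (K : numFieldType) (V : normedModType K).

Definition bounded_functional : {pred V -> K^o} :=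
  mem [set f : V -> K^o | linear f /\ bounded_operator f].

(* The topological dual, as a subspace of the space of all functions V -> K. *)
Record dual := Dual {
  dual_fun :> V -> K^o;
  dualP : dual_fun \in bounded_functional }.

HB.instance Definition _ := [isSub for dual_fun].
HB.instance Definition _ := [Choice of dual by <:].

Lemma bounded_functional_submod : submod_closed bounded_functional.
Proof.
split=> [|a f g /[!inE] -[lf [M hM]] [lg [N hN]]].
  rewrite inE; split; first by move=> a x y; rewrite scaler0 addr0.
  by exists 0 => x; rewrite mul0r normr0.
split.
  move=> b x y; change (a *: f (b *: x + y) + g (b *: x + y) =
    b *: (a *: f x + g x) + (a *: f y + g y)).
  by rewrite lf lg !scalerDr addrACA !scalerA (mulrC a b).
exists (`|a| * M + N) => x; rewrite mulrDl.
apply: (le_trans (ler_normD _ _)); apply: lerD; last exact: hN.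
rewrite -mulrA; apply: (le_trans (y := `|a| * `|f x|)).
  by rewrite -normrM.
exact: ler_wpM2l.
Qed.

HB.instance Definition _ :=
  GRing.isSubmodClosed.Build K (V -> K^o) bounded_functional
    bounded_functional_submod.
HB.instance Definition _ := [SubChoice_isSubLmodule of dual by <:].

End Dual.

Arguments bounded_functional {K} V.

Section Fredholm.
Variable K : numFieldType.
Variables (V W : normedModType K) (A : {linear V -> W}).

Lemma adjoint_subproof (hA : bounded_operator A) (f : dual W) :
  (f \o A : V -> K^o) \in bounded_functional V.
Proof.
have := dualP f; rewrite !inE => -[lf [M hM]]; split.
  by move=> a x y /=; rewrite linearP lf.
have [N hN] := hA; exists (`|M| * N) => x /=.
have M0 : `|f (A x)| <= `|M| * `|A x|.
  have := hM (A x); have [->|Ax0] := eqVneq (`|A x|) 0; first by rewrite !mulr0.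
  have Ap : 0 < `|A x| by rewrite lt0r Ax0 normr_ge0.
  rewrite -!ler_pdivrMr// => h; apply: (le_trans h).
  by rewrite real_ler_norm// (ger0_real (le_trans _ h))// divr_ge0.
by apply: (le_trans M0); rewrite -mulrA; exact: ler_wpM2l.
Qed.

Definition adjoint (hA : bounded_operator A) (f : dual W) : dual V :=
  Dual (adjoint_subproof hA f).

Definition kernel (U U' : lmodType K) (f : U -> U') : set U := f @^-1` [set 0].

(* Used below for kernels only, which are subspaces. *)
Definition finite_dimensional (U : lmodType K) (S : set U) : Prop :=
  exists (n : nat) (b : 'I_n -> U),
    S = range (fun c : 'I_n -> K => \sum_(i < n) c i *: b i).

Definition fredholm (hA : bounded_operator A) : Prop :=
  [/\ closed (range A),
      finite_dimensional (kernel A) &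
      finite_dimensional (kernel (adjoint hA))].

End Fredholm.

Section WeightedLinfty.
Variables (R : realType) (T : Type) (mu : T -> {posnum R}).

Definition weighted_values (f : T -> R[i]) : set R :=
  range (fun v => (mu v)%:num * normc (f v)).

Definition weighted_bounded : {pred T -> R[i]^o} :=
  mem [set f : T -> R[i]^o | has_ubound (weighted_values f)].

Record Linfty := MkLinfty {
  Linfty_fun :> T -> R[i]^o;
  LinftyP : Linfty_fun \in weighted_bounded }.

HB.instance Definition _ := [isSub for Linfty_fun].
HB.instance Definition _ := [Choice of Linfty by <:].

Lemma normcD_le (x y : R[i]) : normc (x + y) <= normc x + normc y.
Proof. exact: le_normcD. Qed.

Lemma normc_ge0 (x : R[i]) : 0 <= normc x.
Proof. by case: x => a b; exact: sqrtr_ge0. Qed.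

Lemma normrCE (x : R[i]) : `|x| = (normc x)%:C.
Proof. by []. Qed.

Lemma weighted_bounded_submod : submod_closed weighted_bounded.
Proof.
split=> [|a f g /[!inE] -[M hM] [N hN]].
  rewrite inE; exists 0 => _ [v _ <-].
  by change ((mu v)%:num * normc (0 : R[i]) <= 0); rewrite normc0 mulr0.
exists (normc a * M + N) => _ [v _ <-].
change ((mu v)%:num * normc (a * f v + g v) <= normc a * M + N).
apply: (le_trans (y := (mu v)%:num * (normc a * normc (f v) + normc (g v)))).
  by rewrite ler_wpM2l// -normcM; exact: normcD_le.
rewrite mulrDr; apply: lerD; last by apply: hN; exists v.
rewrite mulrCA; apply: ler_wpM2l; first exact: normc_ge0.
by apply: hM; exists v.
Qed.

HB.instance Definition _ :=
  GRing.isSubmodClosed.Build R[i] (T -> R[i]^o) weighted_bounded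
    weighted_bounded_submod.
HB.instance Definition _ := [SubChoice_isSubLmodule of Linfty by <:].

Definition Linfty_norm (f : Linfty) : R := sup (weighted_values f).

Lemma Linfty_ubound (f : Linfty) : has_ubound (weighted_values f).
Proof. by have := LinftyP f; rewrite inE. Qed.

Lemma Linfty_norm_ub (f : Linfty) (v : T) :
  (mu v)%:num * normc (f v) <= Linfty_norm f.
Proof. by apply: (ub_le_sup (Linfty_ubound f)); exists v. Qed.

Lemma Linfty_norm_ge0 (f : Linfty) : 0 <= Linfty_norm f.
Proof.
have [[_ [v _ _]]|n0] := pselect (weighted_values f !=set0).
  apply: le_trans (Linfty_norm_ub f v).
  by rewrite mulr_ge0// normc_ge0.
by rewrite /Linfty_norm sup_out// => -[].
Qed.

Lemma Linfty_norm_le (f : Linfty) (M : R) : 0 <= M ->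
  (forall v, (mu v)%:num * normc (f v) <= M) -> Linfty_norm f <= M.
Proof.
move=> M0 h; have [n0|n0] := pselect (weighted_values f !=set0).
  by apply: ge_sup => // _ [v _ <-].
by rewrite /Linfty_norm sup_out// => -[].
Qed.

Lemma Linfty_normD (f g : Linfty) :
  (Linfty_norm (f + g))%:C <= (Linfty_norm f)%:C + (Linfty_norm g)%:C.
Proof.
rewrite -rmorphD lecR; apply: Linfty_norm_le => [|v].
  by rewrite addr_ge0// Linfty_norm_ge0.
apply: le_trans (lerD (Linfty_norm_ub f v) (Linfty_norm_ub g v)).
by rewrite -mulrDr ler_wpM2l//; exact: normcD_le.
Qed.

Lemma Linfty_normZ (a : R[i]) (f : Linfty) :
  (Linfty_norm (a *: f))%:C = `|a| * (Linfty_norm f)%:C.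
Proof.
have le_ (b : R[i]) (g : Linfty) :
    Linfty_norm (b *: g) <= normc b * Linfty_norm g.
  apply: Linfty_norm_le => [|v].
    by rewrite mulr_ge0// ?normc_ge0// Linfty_norm_ge0.
  change ((mu v)%:num * normc (b * g v) <= normc b * Linfty_norm g).
  rewrite normcM mulrCA; apply: ler_wpM2l; first exact: normc_ge0.
  exact: Linfty_norm_ub.
rewrite normrCE -rmorphM; congr (_%:C); apply/eqP; rewrite eq_le le_/=.
have [->|a0] := eqVneq a 0.
  by rewrite normc0 mul0r; exact: Linfty_norm_ge0.
have na0 : 0 < normc a.
  rewrite lt0r normc_ge0 andbT; apply: contra a0 => /eqP h.
  by apply/eqP; exact: eq0_normc.
have := le_ a^-1 (a *: f); rewrite scalerA mulVf// scale1r normcV.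
by rewrite ler_pdivlMl.
Qed.

Lemma Linfty_norm0_eq0 (f : Linfty) : (Linfty_norm f)%:C = 0 -> f = 0.
Proof.
move=> /(congr1 (@complex.Re R)) /= f0; apply: val_inj; apply/funext => v.
apply: eq0_normc; apply/eqP; rewrite eq_le normc_ge0 andbT.
have := Linfty_norm_ub f v; rewrite f0.
by rewrite pmulr_rle0.
Qed.

(* A norm over R[i] must be R[i]-valued, hence the embedding %:C of the sup. *)
HB.instance Definition _ := @Lmodule_isNormed.Build R[i] Linfty
  (fun f => (Linfty_norm f)%:C) Linfty_normD Linfty_normZ Linfty_norm0_eq0.

Variable phi : T -> T.

(* C_phi maps the weighted space into itself; boundedness of C_phi as an operator
   is this together with a norm estimate on comp_op below. *)
Definition composition_maps : Prop :=
  forall f : T -> R[i]^o, f \in weighted_bounded ->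
    (f \o phi : T -> R[i]^o) \in weighted_bounded.

Definition comp_op (h : composition_maps) (f : Linfty) : Linfty :=
  MkLinfty (h f (LinftyP f)).

Lemma comp_op_linear (h : composition_maps) : linear (comp_op h).
Proof. by move=> a f g; apply: val_inj. Qed.

HB.instance Definition _ (h : composition_maps) :=
  GRing.isLinear.Build R[i] Linfty Linfty _ (comp_op h) (comp_op_linear h).

Definition Vset (eps : R) : set T :=
  [set v | eps <= (mu v)%:num / (mu (phi v))%:num].

Definition Sset (w : T) : set T := [set v | phi v = phi w].

End WeightedLinfty.

Definition locally_finite_at (R : realType) (T : metricType R) (o : T) : Prop :=
  forall M : R, 0 < M -> finite_set [set v : T | mdist o v < M].

Definition unbounded_at (R : realType) (T : metricType R) (o : T) : Prop :=
  forall M : R, 0 < M -> exists v : T, M <= mdist o v.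

(* Main.v *)
(** Fix a section [s] of [phi] over its range and write [r = s \o phi].
Functions in [ker C] are those supported off the range of [phi], which gives (a).
The functionals [f |-> f v - f (r v)], for [v] with [r v <> v], are biorthogonal to
the point masses at [v] and annihilate the range of [C]; when (d) holds they also
span the kernel of the adjoint if there are finitely many of them, because
[g - g \o r] is then finitely supported and [g \o r] is in the range.  Finiteness
of [{v | r v <> v}] is (b) and (c) together.

If (d) holds, choosing [s] inside [V_eps] identifies the range of [C] with the
functions that are constant on the fibres, a closed subspace.  For the converse let
[m w] be the supremum of [mu v / mu w] over the fibre of [w] and
[u w = 1 / (mu w * sqrt (m w))].  Then [u \o phi] is the limit of the images of the
truncations of [u] to [m >= d], so a closed range contains it; hence [u] is bounded
on the range of [phi], i.e. [m] is bounded below there.  This avoids the open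
mapping theorem. *)

Require Import Defs.
From HB Require Import structures.
From mathcomp Require Import all_boot all_order all_algebra.
From mathcomp Require Import complex.
From mathcomp Require Import all_classical all_reals all_analysis.
Import Order.TTheory GRing.Theory Num.Theory.
Import numFieldNormedType.Exports.
Import ComplexField.Normc.
Local Open Scope classical_set_scope.
Local Open Scope ring_scope.

Set Implicit Arguments.
Unset Strict Implicit.
Unset Printing Implicit Defensive.

(** * Linear algebra: criteria for finite dimension *)

(** More than [n] indices in [D] would make an identity matrix of size greater than [n] factor
    through dimension [n], against the rank bound. *)
Lemma finite_dimensional_biorthogonal (K : numFieldType) (U : lmodType K)
    (S : set U) (I : choiceType) (D : set I) (x : I -> U)
    (l : I -> {linear U -> K^o}) :
  finite_dimensional S -> (forall i, D i -> S (x i)) ->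
  (forall i j, D i -> D j -> l j (x i) = (i == j)%:R) -> finite_set D.
Proof.
move=> [n [b Sb]] Sx lx; apply: contrapT => Dinf.
have [B BD nB] := infinite_set_fset n.+1 Dinf.
pose s := finmap.enum_fset B.
pose e := tnth (in_tuple s).
have De i : D (e i) by apply: BD; exact: mem_tnth.
have /choice[c xc] (i : 'I_(size s)) : exists c : 'I_n -> K,
    x (e i) = \sum_(k < n) c k *: b k.
  by have := Sx _ (De i); rewrite Sb => -[c _ <-]; exists c.
have CL : (\matrix_(i, k) c i k) *m (\matrix_(k, j) l (e j) (b k)) = 1%:M.
  apply/matrixP => i j; rewrite !mxE.
  have <- : l (e j) (x (e i)) = (i == j)%:R.
    by rewrite lx// (inj_eq (tuple_uniqP _ _))// finmap.fset_uniq.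
  by rewrite xc linear_sum; apply: eq_bigr => k _; rewrite !mxE linearZ.
have := mxrankM_maxl (\matrix_(i, k) c i k) (\matrix_(k, j) l (e j) (b k)).
rewrite CL mxrank1 => /leq_trans/(_ (rank_leq_col _)).
by rewrite leqNgt nB.
Qed.

(** [f] is a bare function with a linearity hypothesis so that the lemma applies to [adjoint hA],
    which carries no linear structure. *)
Lemma finite_dimensional_kernel (K : numFieldType) (U W : lmodType K)
    (f : U -> W) (I : eqType) (s : seq I) (x : I -> U) :
  linear f -> {in s, forall i, Defs.kernel f (x i)} ->
  (forall u, Defs.kernel f u -> exists c : I -> K, u = \sum_(i <- s) c i *: x i) ->
  finite_dimensional (Defs.kernel f).
Proof.
move=> lf fx fgen.
have f0 : f 0 = 0.
  by have := lf (-1) 0 0; rewrite scaler0 addr0 scaleN1r addNr.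
exists (size s), (fun i => x (tnth (in_tuple s) i)).
apply/seteqP; split=> [u /fgen[c ->]|_ [c _ <-]].
  by exists (c \o tnth (in_tuple s)) => //=; rewrite [RHS]big_tnth.
apply: (big_ind (Defs.kernel f)) => [//|u v fu fv|i _].
  by have := lf 1 u v; rewrite /Defs.kernel/= !scale1r fu fv addr0.
have := lf (c i) (x (tnth (in_tuple s) i)) 0.
by rewrite /Defs.kernel/= !addr0 (fx _ (mem_tnth i (in_tuple s))) f0 scaler0 addr0.
Qed.

(** * Sections of a self-map and the sizes of its fibres *)

Lemma exists_section (T : Type) (phi : T -> T) :
  exists s : T -> T, forall v, phi (s (phi v)) = phi v.
Proof.
have /choice[s sP] w : exists v, range phi w -> phi v = w.
  have [[v _ <-]|nw] := pselect (range phi w); first by exists v.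
  by exists w => /nw.
by exists s => v; apply: sP; exists v.
Qed.

Section Fibres.
Variables (T : Type) (phi s : T -> T).
Hypothesis sK : forall v, phi (s (phi v)) = phi v.
Local Notation nonsection := [set v | s (phi v) <> v].

(** Each fibre over the range has exactly one point outside [nonsection], the value of [s]. So the
    fibres meeting [nonsection] are exactly those with several points. *)
Lemma finite_nonsection_fibres :
  finite_set nonsection <->
  (exists M : nat, forall w : T, range phi w ->
     (phi @^-1` [set w] #<= `I_M)%card) /\
  finite_set [set w | range phi w /\ ~ (exists! v : T, phi v = w)].
Proof.
split=> [fN|[[M hM] fE]].
  have /finite_set_leP[n hn] : finite_set (nonsection `|` s @` (phi @` nonsection)).
    by rewrite finite_setU; split => //; do 2 apply: finite_image.
  split.
    (* [n] bounds the fibres that meet [nonsection]; the successor also covers singleton fibres when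
       [n] is 0. *)
    exists n.+1 => _ [u _ <-].
    have [[v [vu vN]]|noN] := pselect (exists v, phi v = phi u /\ nonsection v).
      apply: card_le_trans (_ : (_ #<= `I_n)%card) _; last by rewrite card_le_II.
      apply: card_le_trans hn; apply: subset_card_le => v' v'u.
      have [v's|] := pselect (s (phi v') = v'); last by left.
      by right; exists (phi v'); [exists v => //; rewrite vu|].
    apply: (@card_le_trans _ _ _ `I_1); last by rewrite card_le_II.
    rewrite -(card_le_eqr (card_set1 (x := s (phi u)))).
    apply: subset_card_le => v vu; apply: contrapT => vs.
    by apply: noN; exists v; split => // svv; apply: vs; rewrite /= -svv vu.
  apply: sub_finite_set (finite_image phi fN) => _ [[u _ <-] nu].
  apply: contrapT => noN; apply: nu; exists (s (phi u)); split => // v vu.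
  by rewrite -vu; apply: contrapT => vs; apply: noN; exists v.
(* Conversely, [nonsection] lies in the union of the finitely many exceptional fibres, each finite
   by the bound [M]. *)
have fU := bigcup_finite fE (F := fun w => phi @^-1` [set w]).
apply: sub_finite_set (fU _) => [v vN|w [/hM wM _]]; last first.
  by apply/finite_set_leP; exists M.
exists (phi v) => //; split; first by exists v.
by move=> [u [_ uE]]; apply: vN; rewrite -(uE _ (sK v)) (uE v).
Qed.

End Fibres.

Lemma normc_ge0_real (R : realType) (a : R) : 0 <= a -> normc (a%:C)%C = a.
Proof. by move=> a0; rewrite /normc /= expr0n/= addr0 sqrtr_sqr ger0_norm. Qed.

(** * The dual space and the kernel of the adjoint *)

Section Dual.
Variables (K : numFieldType) (V : normedModType K).

Lemma dual_linear (f : dual V) : linear f.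
Proof. by have := dualP f; rewrite inE => -[]. Qed.

HB.instance Definition _ (f : dual V) :=
  GRing.isLinear.Build K V K^o _ (dual_fun f) (dual_linear f).

(** Evaluation is named so that it can carry a linear structure: it provides the functionals dual to
    a family in [dual V], and it passes through finite sums there. *)
Definition dual_eval (x : V) (f : dual V) : K^o := f x.

Lemma dual_eval_linear (x : V) : linear (dual_eval x).
Proof. by []. Qed.

HB.instance Definition _ (x : V) :=
  GRing.isLinear.Build K (dual V) K^o _ (dual_eval x) (dual_eval_linear x).

Lemma adjoint_linear (W : normedModType K) (A : {linear W -> V})
  (hA : bounded_operator A) : linear (adjoint hA).
Proof. by move=> a f g; apply: val_inj. Qed.

Lemma kernel_adjointP (W : normedModType K) (A : {linear W -> V})
  (hA : bounded_operator A) (f : dual V) :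
  Defs.kernel (adjoint hA) f <-> forall x, f (A x) = 0.
Proof.
split=> [f0 x|f0]; first exact: (congr1 (fun g : dual W => g x) f0).
by apply: val_inj; apply/funext => x; exact: f0.
Qed.

End Dual.

(** * Point evaluations, point masses and closures in the weighted space *)

Section WeightedLinfty.
Variables (R : realType) (T : choiceType) (mu : T -> {posnum R}).
Implicit Types (f g : Linfty mu) (v w : T).

Lemma weighted_boundedP (f : T -> R[i]^o) :
  reflect (exists M, forall v, (mu v)%:num * normc (f v) <= M)
    (f \in weighted_bounded mu).
Proof.
apply: (iffP idP) => [|[M fM]]; rewrite inE.
  by move=> -[M fM]; exists M => v; apply: fM; exists v.
by exists M => _ [v _ <-].
Qed.

Definition point_eval v f : R[i]^o := f v.

Lemma point_eval_linear v : linear (point_eval v).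
Proof. by []. Qed.

HB.instance Definition _ v :=
  GRing.isLinear.Build R[i] (Linfty mu) R[i]^o _ _ (point_eval_linear v).

Lemma point_eval_bounded v : point_eval v \in bounded_functional (Linfty mu).
Proof.
rewrite inE; split; first exact: point_eval_linear.
exists ((mu v)%:num^-1)%:C%C => f.
rewrite normrCE -[X in _ * X]/((Linfty_norm f)%:C)%C -rmorphM lecR.
by rewrite ler_pdivlMl// Linfty_norm_ub.
Qed.

Definition point_functional v : dual (Linfty mu) := Dual (point_eval_bounded v).

Lemma point_mass_bounded w :
  (fun v => (v == w)%:R : R[i]^o) \in weighted_bounded mu.
Proof.
apply/weighted_boundedP; exists (mu w)%:num => v.
by case: eqVneq => [->|_]; rewrite ?normc1 ?mulr1// normc0 mulr0.
Qed.

Definition point_mass w : Linfty mu := MkLinfty (point_mass_bounded w).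

Lemma finite_support_sum f (s : seq T) : uniq s ->
  (forall v, v \notin s -> f v = 0) ->
  f = \sum_(w <- s) f w *: point_mass w.
Proof.
move=> us fs; apply: val_inj; apply/funext => v.
transitivity (point_eval v (\sum_(w <- s) f w *: point_mass w)); last by [].
have -> : point_eval v (\sum_(w <- s) f w *: point_mass w) =
    \sum_(w <- s) f w * (v == w)%:R by rewrite linear_sum.
have [vs|vs] := boolP (v \in s).
  rewrite (bigD1_seq v)//= eqxx mulr1 big1 ?addr0// => w wv.
  by rewrite eq_sym (negbTE wv) mulr0.
rewrite [LHS]fs// big_seq big1// => w ws.
by case: eqVneq => [vw|_]; rewrite ?mulr0//; rewrite vw ws in vs.
Qed.

Lemma Linfty_closureP (S : set (Linfty mu)) f :
  closure S f <->
  forall e : R, 0 < e -> exists2 g, S g & Linfty_norm (f - g) < e.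
Proof.
split=> [Sf e e0|Sf B /nbhs_normP[e /= e0 eB]].
  have e0C : 0 < (e%:C)%C by rewrite ltcR.
  have [g [Sg fg]] := Sf _ (nbhsx_ballx f _ e0C).
  by exists g => //; move: fg; rewrite -ball_normE/= ltcR.
(* Radii live in [R[i]], where a positive element has zero imaginary part. *)
have eE : e = ((complex.Re e)%:C)%C.
  rewrite [LHS]complexE; move: e0; rewrite ltcE/=.
  by move=> /andP[/eqP-> _]; rewrite mulr0 addr0.
have [|g Sg fg] := Sf (complex.Re e); first by rewrite -ltcR -eE.
by exists g; split => //; apply: eB => /=; rewrite eE ltcR.
Qed.

End WeightedLinfty.

(** * Kernel and range of the composition operator *)

Section Composition.
Variables (R : realType) (T : choiceType) (mu : T -> {posnum R}) (phi : T -> T).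
Hypothesis phi_maps : composition_maps mu phi.
Local Notation C := (comp_op phi_maps).
Local Notation weight_ratio := (fun v => (mu v)%:num / (mu (phi v))%:num).

(** The function [1 / mu] lies in the space, and the weighted values of its image under [C] are
    exactly these ratios. *)
Lemma ratio_bounded : exists B, forall v, weight_ratio v <= B.
Proof.
have : (fun w => ((mu w)%:num^-1)%:C%C : R[i]^o) \in weighted_bounded mu.
  apply/weighted_boundedP; exists 1 => w.
  by rewrite normc_ge0_real ?invr_ge0// divff.
move=> /phi_maps/weighted_boundedP[B hB]; exists B => v.
have := hB v; rewrite -[normc _]/(normc ((mu (phi v))%:num^-1)%:C%C).
by rewrite normc_ge0_real// invr_ge0.
Qed.

Lemma kernel_compP (f : Linfty mu) :
  Defs.kernel C f <-> forall v, f (phi v) = 0.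
Proof.
split=> [f0 v|f0]; first exact: (congr1 (fun g : Linfty mu => g v) f0).
by apply: val_inj; apply/funext => v; exact: f0.
Qed.

Lemma finite_dimensional_kernel_comp :
  finite_dimensional (Defs.kernel C) <-> finite_set (~` range phi).
Proof.
split=> [fdC|/finite_fsetP[B rB]].
  apply: (@finite_dimensional_biorthogonal _ _ _ _ _
    (point_mass mu) (point_eval (mu := mu)) fdC).
    move=> w nw; apply/kernel_compP => v; rewrite /=.
    by case: eqVneq => // vw; case: nw; exists v.
  by move=> w w' _ _; rewrite /point_eval/= eq_sym.
apply: (@finite_dimensional_kernel _ _ _ _ _ (finmap.enum_fset B)
  (point_mass mu)).
- exact: comp_op_linear.
- move=> w wB; apply/kernel_compP => v /=.
  have : (~` range phi) w by rewrite rB.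
  by case: eqVneq => // vw []; exists v.
- move=> f /kernel_compP f0; exists f.
  apply: finite_support_sum => [|w]; first exact: finmap.fset_uniq.
  apply: contraNeq => fw; suff : (~` range phi) w by rewrite rB.
  by move=> [v _ vw]; rewrite -vw f0 eqxx in fw.
Qed.

(** On the range [mu w <= mu (s w) / eps], so moving [g] along [s] costs a factor of at most
    [1 / eps]. Off the range, where [s] is uncontrolled, the preimage is set to 0. *)
Lemma section_preimage (s : T -> T) (eps : R) : 0 < eps ->
  (forall v, phi (s (phi v)) = phi v) ->
  (forall v, eps <= weight_ratio (s (phi v))) ->
  forall g : Linfty mu, exists f, forall v, C f v = g (s (phi v)).
Proof.
move=> eps0 sK seps g.
pose f w : R[i]^o := if `[< range phi w >] then g (s w) else 0.
have fb : f \in weighted_bounded mu.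
  apply/weighted_boundedP; exists (Linfty_norm g / eps) => w; rewrite /f.
  case: asboolP => [[v _ <-]|_]; last first.
    by rewrite normc0 mulr0 divr_ge0// ?Linfty_norm_ge0// ltW.
  rewrite ler_pdivlMr// mulrAC.
  apply: le_trans (Linfty_norm_ub g (s (phi v))).
  apply: ler_wpM2r; first exact: normc_ge0.
  by have := seps v; rewrite sK ler_pdivlMr// mulrC.
exists (MkLinfty fb) => v.
by rewrite /= /f; case: asboolP => // -[]; exists v.
Qed.

Lemma range_compP (s : T -> T) (eps : R) : 0 < eps ->
  (forall v, phi (s (phi v)) = phi v) ->
  (forall v, eps <= weight_ratio (s (phi v))) ->
  forall g, range C g <-> forall v, g v = g (s (phi v)).
Proof.
move=> eps0 sK seps g; split=> [[f _ <-] v|gs]; first by rewrite /= sK.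
have [f fg] := section_preimage eps0 sK seps g.
by exists f => //; apply: val_inj; apply/funext => v; rewrite [LHS]fg -gs.
Qed.

Lemma closed_range_comp (s : T -> T) (eps : R) : 0 < eps ->
  (forall v, phi (s (phi v)) = phi v) ->
  (forall v, eps <= weight_ratio (s (phi v))) ->
  closed (range C).
Proof.
move=> eps0 sK seps g /Linfty_closureP gr.
apply/(range_compP eps0 sK seps) => v; set r := s (phi v).
apply/eqP; rewrite -subr_eq0; apply/eqP/eq0_normc/eqP.
rewrite eq_le normc_ge0 andbT; apply/ler_addgt0Pl => e e0; rewrite addr0.
(* Evaluation at a point [x] has norm at most [1 / mu x], so an approximant within [e / m] changes
   [g v] and [g r] by at most [e] in total. *)
pose m : R := (mu v)%:num^-1 + (mu r)%:num^-1.
have m0 : 0 < m by rewrite addr_gt0// invr_gt0.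
have [h hr gh] := gr (e / m) (divr_gt0 e0 m0).
have hv : h v = h r := (range_compP eps0 sK seps h).1 hr v.
have gh_le u : normc (g u - h u) <= (mu u)%:num^-1 * (e / m).
  by rewrite ler_pdivlMl//; exact: le_trans (Linfty_norm_ub (g - h) u) (ltW gh).
have -> : g v - g r = (g v - h v) - (g r - h r) by rewrite hv opprB addrA subrK.
apply: (le_trans (normcD_le _ _)); rewrite normcN.
apply: (le_trans (lerD (gh_le v) (gh_le r))).
by rewrite -mulrDl -/m mulrC divfK// gt_eqF.
Qed.

Lemma closed_range_lower_bound : closed (range C) ->
  exists eps : R, 0 < eps /\ forall w, (Vset mu phi eps `&` Sset phi w) !=set0.
Proof.
move=> clC; have [B hB] := ratio_bounded.
pose ratios w := [set weight_ratio v | v in phi @^-1` [set w]].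
pose m w := sup (ratios w).
have ratios_ub w : has_ubound (ratios w) by exists B => _ [v _ <-].
have m_ge v : weight_ratio v <= m (phi v) by apply: ub_le_sup => //; exists v.
have m0 v : 0 < m (phi v) by apply: lt_le_trans (m_ge v); rewrite divr_gt0.
(* The square root balances two demands: the weighted values of [u \o phi] are at most [sqrt m],
   hence small where [m] is small, while those of [u] on the range are [1 / sqrt m], hence large
   there. *)
pose u w : R[i]^o := (((mu w)%:num * Num.sqrt (m w))^-1)%:C%C.
have u_val v : (mu v)%:num * normc (u (phi v)) <= Num.sqrt (m (phi v)).
  rewrite /u normc_ge0_real ?invr_ge0 ?mulr_ge0 ?sqrtr_ge0//.
  rewrite invfM mulrA ler_pdivrMr ?sqrtr_gt0// -expr2 sqr_sqrtr ?(ltW (m0 v))//.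
have ub : (u \o phi : T -> R[i]^o) \in weighted_bounded mu.
  apply/weighted_boundedP; exists (Num.sqrt B) => v.
  apply: le_trans (u_val v) _.
  rewrite ler_wsqrtr//; apply: ge_sup; first by exists (weight_ratio v), v.
  by move=> _ [t _ <-].
have : range C (MkLinfty ub).
  apply: clC; apply/Linfty_closureP => e e0.
  (* With [sqrt d = e / 2], the part of [u \o phi] discarded where [m < d] has norm at most
     [e / 2]. *)
  pose d := (e / 2) ^+ 2.
  have d0 : 0 < d by rewrite exprn_gt0 ?divr_gt0.
  pose f w : R[i]^o := if `[< range phi w >] && (d <= m w) then u w else 0.
  have fb : f \in weighted_bounded mu.
    apply/weighted_boundedP; exists (Num.sqrt d)^-1 => w; rewrite /f.
    case: ifPn => [/andP[_ dm]|_]; last by rewrite normc0 mulr0 invr_ge0 sqrtr_ge0.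
    rewrite /u normc_ge0_real ?invr_ge0 ?mulr_ge0 ?sqrtr_ge0//.
    rewrite invfM mulrA divff// mul1r lef_pV2 ?posrE ?sqrtr_gt0//.
      by rewrite ler_wsqrtr.
    exact: lt_le_trans dm.
  exists (C (MkLinfty fb)); first by exists (MkLinfty fb).
  apply: (@le_lt_trans _ _ (e / 2)); last by rewrite gtr_pMr// invf_lt1// ltr1n.
  apply: Linfty_norm_le => [|v]; first by rewrite divr_ge0// ltW.
  rewrite -[X in normc X]/(u (phi v) - f (phi v)) /f.
  have -> : `[< range phi (phi v) >] by apply/asboolP; exists v.
  rewrite andTb; case: ifPn => [dm|]; last rewrite -ltNge => md.
    by rewrite subrr normc0 mulr0 divr_ge0// ltW.
  rewrite subr0; apply: le_trans (u_val v) _.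
  rewrite -(@ger0_norm _ (e / 2)) ?divr_ge0 ?(ltW e0)// -sqrtr_sqr.
  by rewrite ler_wsqrtr// ltW.
move=> [f _ /(congr1 (fun h : Linfty mu => (h : T -> R[i]^o)))] fg.
(* The preimage [f] agrees with [u] on the range, so its norm bounds [1 / sqrt m] there; adding 1
   makes [K] positive. *)
pose K := Linfty_norm f + 1.
have K0 : 0 < K by rewrite ltr_pwDr// Linfty_norm_ge0.
(* The bound is [K ^- 2 <= m]; halving makes it strict, so that a point of the fibre exceeds it
   although the supremum [m] may not be attained. *)
exists (K ^- 2 / 2); split; first by rewrite divr_gt0// invr_gt0 exprn_gt0.
move=> w; have mK : K ^- 2 / 2 < m (phi w).
  apply: (@lt_le_trans _ _ (K ^- 2)).
    by rewrite gtr_pMr ?invf_lt1 ?ltr1n// invr_gt0 exprn_gt0.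
  have : (mu (phi w))%:num * normc (f (phi w)) <= K.
    by apply: le_trans (Linfty_norm_ub f (phi w)) _; rewrite lerDl.
  have -> : f (phi w) = u (phi w) by rewrite -[RHS](congr1 (@^~ w) fg).
  rewrite /u normc_ge0_real ?invr_ge0 ?mulr_ge0 ?sqrtr_ge0//.
  rewrite invfM mulrA divff// mul1r => mK.
  have sm0 : 0 < Num.sqrt (m (phi w)) by rewrite sqrtr_gt0.
  rewrite -[leRHS]sqr_sqrtr ?(ltW (m0 w))// -exprVn lerXn2r//
    ?nnegrE ?invr_ge0 ?(ltW K0) ?(ltW sm0)//.
  by rewrite -[leRHS]invrK lef_pV2 ?posrE ?invr_gt0.
have ratios0 : ratios (phi w) !=set0 by exists (weight_ratio w), w.
have [_ [v vw <-] mv] := sup_gt ratios0 mK.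
by exists v; split => //; rewrite /Vset/= ltW.
Qed.

(** * The kernel of the adjoint *)

Section Cokernel.
Variables (C_bounded : bounded_operator C) (s : T -> T).
Hypothesis sK : forall v, phi (s (phi v)) = phi v.

Lemma kernel_adjoint_difference v :
  Defs.kernel (adjoint C_bounded)
    (point_functional mu v - point_functional mu (s (phi v))).
Proof.
apply/kernel_adjointP => f.
rewrite -[LHS]/(f (phi v) - f (phi (s (phi v)))).
by rewrite sK subrr.
Qed.

Lemma finite_nonsection :
  finite_dimensional (Defs.kernel (adjoint C_bounded)) ->
  finite_set [set v | s (phi v) <> v].
Proof.
move=> fdA.
apply: (@finite_dimensional_biorthogonal _ _ _ _ _
  (fun v => point_functional mu v - point_functional mu (s (phi v)))
  (fun v => dual_eval (point_mass mu v)) fdA) => [v _|v w vN wN].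
  exact: kernel_adjoint_difference.
rewrite -[LHS]/((v == w)%:R - (s (phi v) == w)%:R).
(* Values of [s \o phi] are fixed by [s \o phi], whereas [w] is not. *)
have -> : (s (phi v) == w) = false; last by rewrite subr0.
by apply/eqP => vw; apply: wN; rewrite -vw sK.
Qed.

Lemma finite_dimensional_cokernel (eps : R) : 0 < eps ->
  (forall v, eps <= weight_ratio (s (phi v))) ->
  finite_set [set v | s (phi v) <> v] ->
  finite_dimensional (Defs.kernel (adjoint C_bounded)).
Proof.
move=> eps0 seps /finite_fsetP[B NB].
apply: (@finite_dimensional_kernel _ _ _ _ _ (finmap.enum_fset B)
  (fun v => point_functional mu v - point_functional mu (s (phi v)))).
- exact: adjoint_linear.
- by move=> v _; exact: kernel_adjoint_difference.
(* The coefficients are forced by biorthogonality with the point masses. *)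
move=> l /kernel_adjointP l0; exists (fun v => l (point_mass mu v)).
apply: val_inj; apply/funext => g.
have [f fs] := section_preimage eps0 sK seps g.
have gf v : (g - C f) v = g v - g (s (phi v)) by rewrite -fs.
have {1}-> : g = (g - C f) + C f by rewrite subrK.
transitivity (l (g - C f)); first by rewrite /= linearD/= l0 addr0.
rewrite [in LHS](@finite_support_sum _ _ _ (g - C f) (finmap.enum_fset B)).
- rewrite linear_sum -[RHS]/(dual_eval g _) linear_sum; apply: eq_bigr => v _.
  by rewrite linearZ gf -[RHS]/(_ * (g v - g (s (phi v)))) mulrC.
- exact: finmap.fset_uniq.
move=> v; rewrite gf; apply: contraNeq => gv.
suff : [set v | s (phi v) <> v] v by rewrite NB.
by move=> sv; rewrite sv subrr eqxx in gv.
Qed.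
End Cokernel.

End Composition.

Theorem corollary7p9 (R : realType) (T : metricType R) (o : T)
    (T_lf : locally_finite_at o) (T_unb : unbounded_at o)
    (mu : T -> {posnum R}) (phi : T -> T)
    (phi_maps : composition_maps mu phi)
    (C_bounded : bounded_operator (comp_op phi_maps)) :
  fredholm C_bounded <->
  [/\ finite_set (~` range phi),
      (exists M : nat, forall w : T, range phi w ->
         (phi @^-1` [set w] #<= `I_M)%card),
      finite_set [set w | range phi w /\ ~ (exists! v : T, phi v = w)] &
      (exists eps : R, 0 < eps /\
         forall w : T, (Vset mu phi eps `&` Sset phi w) !=set0)].
Proof.
split=> [[clC kerC kerA]|[fa fb fc [eps [eps0 hd]]]].
  have [s sK] := exists_section phi.
  have [hb hc] := (finite_nonsection_fibres sK).1 (finite_nonsection sK kerA).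
  split=> //; first exact: (finite_dimensional_kernel_comp phi_maps).1 kerC.
  exact: closed_range_lower_bound clC.
(* Condition (d) lets a single section take all its values over the range in [Vset]; it serves both
   the closed range and the cokernel. *)
have /choice[s sP] w : exists v, range phi w ->
    phi v = w /\ eps <= (mu v)%:num / (mu (phi v))%:num.
  have [[u _ <-]|nw] := pselect (range phi w); last by exists w => /nw.
  by have [v [vV vu]] := hd u; exists v.
have sK v : phi (s (phi v)) = phi v by apply: (sP _ _).1; exists v.
have seps v : eps <= (mu (s (phi v)))%:num / (mu (phi (s (phi v))))%:num.
  by apply: (sP _ _).2; exists v.
split.
- exact: closed_range_comp eps0 sK seps.
- exact: (finite_dimensional_kernel_comp phi_maps).2 fa.
- apply: finite_dimensional_cokernel eps0 seps _ => //.
  exact/(finite_nonsection_fibres sK).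
Qed.
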